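(* Let $m,n\geq1$ be integers and $p\in(0,1)$ be fixed, $q=1-p$. For $t>0$ let $G^{(p)}_{n,m}(t):=\mathbb{E}_{\nu^{(p)}_{n,m}}\bigl[t^{\operatorname{des}(\pi)+1}\bigr]$. Then $$G^{(p)}_{n,m}(t)=\frac{1}{m^n}[u^n]\,(1+u)^{m-1}\left(A_t(u)\,\frac{1-\omega_t(u)}{1+\omega_t(u)}\right)^{n+1}\sum_{k\geq1}k^n\omega_t(u)^k,$$ where $A_t(u):=1+t+(p+qt)u$ and $\omega_t(u)$ is the solution of $$\frac{\omega_t(u)}{(1+\omega_t(u))^2}=\frac{t(1+u)}{A_t(u)^2},\qquad \omega_1(u)=\frac{1}{1+u}.$$
   Context: Asymmetric shelf shuffle: let $m\ge 1$ be an integer, $p\in(0,1)$, $q=1-p$. A deck of $n$ cards labelled $1,\ldots,n$ from top to bottom is dealt sequentially from the bottom (card $n$ first, card $1$ last). Each card is assigned to one of $m$ labelled shelves independently and uniformly at random, and is placed at the top of the existing pile on that shelf with probability $p$ and at the bottom with probability $q$, independently of everything else. The shuffled deck is formed by joining the piles in shelf order (shelf $1$ on top, then shelf $2$, and so on). The resulting random permutation is $\pi=(\pi_1,\ldots,\pi_n)\in S_n$, where $\pi_i$ is the label of the card in position $i$ from the top, and $\nu^{(p)}_{n,m}$ denotes its law on $S_n$. $\operatorname{des}(\pi)=|\{i\in\{1,\ldots,n-1\}:\pi_i>\pi_{i+1}\}|$ is the number of descents. Branch convention: for $t>0$ and $u>0$, the quadratic equation for $\omega_t(u)$ has two distinct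 positive roots, reciprocal to each other; $\omega_t(u)$ is the root lying in $(0,1)$, i.e. the one depending continuously on $t$ with $\omega_1(u)=1/(1+u)$. For fixed $t>0$, the expression to the right of $[u^n]$ is then a function of $u>0$ which coincides with a polynomial in $u$, and $[u^n]$ denotes the coefficient of $u^n$ in that polynomial. *)

(* Defs.v *)
From HB Require Import structures.
From mathcomp Require Import all_boot all_order all_algebra all_fingroup.
From mathcomp Require Import all_classical all_reals all_analysis.
From mathcomp Require Import ring lra.

Set Implicit Arguments.
Unset Strict Implicit.
Unset Printing Implicit Defensive.

Import Order.TTheory GRing.Theory Num.Theory.
Import numFieldNormedType.Exports.

Local Open Scope classical_set_scope.
Local Open Scope ring_scope.

(* Cards and positions are 0-based: the ordinal i : 'I_n stands for the card
   with label i.+1, and for the (i.+1)-th position from the top of the deck.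
   A pile is listed from top to bottom. *)

(* The random choices: card c goes to shelf (w c).1, on top of the pile there
   if (w c).2 and at the bottom otherwise. *)
Definition choices (n m : nat) := {ffun 'I_n -> 'I_m * bool}.

Definition choices_prob (R : realType) (n m : nat) (p : R) (w : choices n m) : R :=
  \prod_(c < n) (m%:R^-1 * (if (w c).2 then p else 1 - p)).

Definition deal_card (n m : nat) (w : choices n m)
    (piles : 'I_m -> seq 'I_n) (c : 'I_n) : 'I_m -> seq 'I_n :=
  fun s => if s == (w c).1 then
             if (w c).2 then c :: piles s else rcons (piles s) c
           else piles s.

(* The last card of the deck is dealt first. *)
Definition final_piles (n m : nat) (w : choices n m) : 'I_m -> seq 'I_n :=
  foldl (deal_card w) (fun=> [::]) (rev (enum 'I_n)).

Definition shuffled_deck (n m : nat) (w : choices n m) : seq 'I_n :=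
  flatten [seq final_piles w s | s <- enum 'I_m].

(* The law nu^(p)_{n,m}, as a mass function on S_n; pi i is the card in
   position i. *)
Definition shelf_law (R : realType) (n m : nat) (p : R) (pi : {perm 'I_n}) : R :=
  \sum_(w : choices n m | shuffled_deck w == [seq pi i | i <- enum 'I_n])
     choices_prob p w.

Definition des (n : nat) (pi : {perm 'I_n}) : nat :=
  #|[pred i : 'I_n | [exists j : 'I_n, (j == i.+1 :> nat) && (pi j < pi i)%N]]|.

Definition des_gf (R : realType) (n m : nat) (p t : R) : R :=
  \sum_(pi : {perm 'I_n}) shelf_law m p pi * t ^+ (des pi).+1.

Definition Afun (R : realType) (p t u : R) : R :=
  1 + t + (p + (1 - p) * t) * u.

Definition omega_root (R : realType) (p t u : R) : set R :=
  [set w | 0 < w < 1 /\ w / (1 + w) ^+ 2 = t * (1 + u) / Afun p t u ^+ 2].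

(* The default value 0 is irrelevant for 0 < p < 1 and t, u > 0: see
   omega_exists_unique. *)
Definition omega (R : realType) (p t u : R) : R := xget 0 (omega_root p t u).

Section OmegaTheory.
Variables (R : realType) (p : R).
Hypothesis p01 : 0 < p < 1.

Let disc (t u : R) : R := Afun p t u ^+ 2 - 4 * t * (1 + u).

Let Afun_gt0 (t u : R) : 0 < t -> 0 < u -> 0 < Afun p t u.
Proof.
move=> t0 u0; have /andP[p0 p1] := p01.
have h : 0 < (p + (1 - p) * t) * u.
  by rewrite mulr_gt0// addr_gt0// mulr_gt0// subr_gt0.
by rewrite /Afun; lra.
Qed.

Let disc_gt0 (t u : R) : 0 < t -> 0 < u -> 0 < disc t u.
Proof.
move=> t0 u0; have /andP[p0 p1] := p01.
have q0 : 0 < 1 - p by rewrite subr_gt0.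
have -> : disc t u = ((1 - t) + (p - (1 - p) * t) * u) ^+ 2
                     + 4 * (p * (1 - p)) * t * u ^+ 2.
  by rewrite /disc /Afun; ring.
by rewrite ltr_wpDl ?sqr_ge0 // !mulr_gt0 // exprn_gt0.
Qed.

Let closed (t u : R) : R := (Afun p t u - Num.sqrt (disc t u)) /
                      (Afun p t u + Num.sqrt (disc t u)).

Let root_closed (t u : R) : 0 < t -> 0 < u -> omega_root p t u (closed t u).
Proof.
move=> t0 u0; have A0 := Afun_gt0 t0 u0; have D0 := disc_gt0 t0 u0.
set A := Afun p t u in A0 *; set s := Num.sqrt (disc t u).
have s0 : 0 < s by rewrite sqrtr_gt0.
have s2 : s ^+ 2 = A ^+ 2 - 4 * t * (1 + u) by rewrite sqr_sqrtr ?ltW.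
have tu : 0 < t * (1 + u) by rewrite mulr_gt0 // addr_gt0.
have sA : s < A.
  by rewrite -(ltr_pXn2r (n := 2)) ?nnegrE ?ltW // s2; lra.
have As : 0 < A + s by rewrite addr_gt0.
split; rewrite /closed -/A -/s.
  by rewrite divr_gt0 ?subr_gt0 // ltr_pdivrMr // mul1r; lra.
have -> : t * (1 + u) = (A ^+ 2 - s ^+ 2) / 4 by rewrite s2; field.
by field; rewrite !gt_eqF //=; lra.
Qed.

Let root_unique (t u v w : R) :
  omega_root p t u v -> omega_root p t u w -> v = w.
Proof.
move=> [/andP[v0 v1] ev] [/andP[w0 w1] ew].
have e : v * (1 + w) ^+ 2 = w * (1 + v) ^+ 2.
  have := etrans ev (esym ew); move/eqP; rewrite eqr_div; first by move/eqP.
    by rewrite gt_eqF // exprn_gt0 // addr_gt0.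
  by rewrite gt_eqF // exprn_gt0 // addr_gt0.
have /eqP : (v - w) * (1 - v * w) = 0.
  by transitivity (v * (1 + w) ^+ 2 - w * (1 + v) ^+ 2);
    [ring | rewrite e subrr].
rewrite mulf_eq0 => /orP[|]; first by rewrite subr_eq0 => /eqP.
by rewrite subr_eq0 gt_eqF // mulr_ilt1 // ltW.
Qed.

Lemma omega_exists_unique (t u : R) : 0 < t -> 0 < u -> exists! w, omega_root p t u w.
Proof.
move=> t0 u0; exists (closed t u); split; first exact: root_closed.
by move=> w; apply: root_unique; exact: root_closed.
Qed.

Lemma omegaP (t u : R) : 0 < t -> 0 < u -> omega_root p t u (omega p t u).
Proof. by move=> t0 u0; apply: xgetPex; exists (closed t u); exact: root_closed. Qed.

Lemma omega_at1 (u : R) : 0 < u -> omega p 1 u = 1 / (1 + u).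
Proof.
move=> u0; apply: (@root_unique 1 u); first exact: omegaP.
split; first by rewrite divr_gt0 ?addr_gt0 //= ltr_pdivrMr ?addr_gt0 // mul1r ltrDl.
have -> : Afun p 1 u = 2 + u by rewrite /Afun; ring.
by field; rewrite !gt_eqF //=; lra.
Qed.

Lemma omega_continuous (u : R) : 0 < u ->
  {in [pred t : R | 0 < t], continuous (fun t => omega p t u)}.
Proof.
move=> u0 t; rewrite inE => t0.
have A0 := Afun_gt0 t0 u0.
have omegaE (x : R) : 0 < x -> omega p x u = closed x u.
  by move=> x0; apply: (@root_unique x u); [exact: omegaP|exact: root_closed].
have cA : {for t, continuous (fun x => Afun p x u)}.
  rewrite /Afun; apply: cvgD; first by apply: cvgD; [exact: cvg_cst|exact: cvg_id].
  apply: cvgM; last exact: cvg_cst.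
  apply: cvgD; first exact: cvg_cst.
  by apply: cvgM; [exact: cvg_cst|exact: cvg_id].
have cs : {for t, continuous (fun x => Num.sqrt (disc x u))}.
  apply: (@continuous_comp _ _ _ (fun x => disc x u) Num.sqrt); last exact: sqrt_continuous.
  apply: cvgB.
    by under eq_fun do rewrite expr2; apply: cvgM.
  apply: cvgM; last exact: cvg_cst.
  by apply: cvgM; [exact: cvg_cst|exact: cvg_id].
rewrite /continuous_at omegaE //.
apply: (@cvg_trans _ ((fun x => closed x u) @ t)).
  apply: near_eq_cvg; near=> x; apply/esym/omegaE.
  by near: x; exact: lt_nbhsr.
apply: (@continuousM _ _ (fun x => Afun p x u - Num.sqrt (disc x u))
  (fun x => (Afun p x u + Num.sqrt (disc x u))^-1)).
  exact: (continuousB cA cs).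
apply: continuousV; last exact: (continuousD cA cs).
by rewrite gt_eqF // addr_gt0 // sqrtr_gt0 disc_gt0.
Unshelve. all: by end_near.
Qed.

End OmegaTheory.

(* Main.v *)
From mathcomp Require Import all_boot all_order all_algebra all_fingroup.
From mathcomp Require Import all_classical all_reals all_analysis.
From mathcomp Require Import ring lra zify.
Require Import Defs.

(** The shuffled deck is a concatenation of [m] piles, each increasing and then
    decreasing, so the probability of [pi] depends only on which adjacent pairs
    of [pi] ascend and which descend.  Cutting [pi] into such piles means
    deleting some adjacent pairs; a pair left inside a pile contributes a factor
    [p] if it ascends and [1 - p] if it descends, and the only obstruction is a
    valley (a descent immediately followed by an ascent) none of whose two pairs
    is cut.  Marking uncut pairs by [u] yields
      [m ^ n * nu(pi) = [u^n] (1 + u)^m * x^v * a^(asc - v) * b^(des - v)]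
    with [v] valleys, [a = 1 + p u], [b = 1 + (1 - p) u] and
    [x = a b - p (1 - p) u^2 = 1 + u] ([shelf_law_coef]).

    The sum over all permutations of [x^v * a^(asc - v) * b^(des - v)] depends
    on [a] and [b] only through [a + b] ([valley_sum_invariant]): this is the
    enumerative content of the Foata-Strehl valley-hopping action.  After [t]
    has been absorbed, [a + b] is [A_t(u)] and [x] is [t (1 + u)].  Hence [a] and
    [b] may be traded for [c] and [e] with [c + e = A_t(u)] and
    [c e = t (1 + u)]; the equation for [omega] says exactly that
    [c = A_t(u) / (1 + omega)], [e = c omega] works.  Since now [x = c e],
    valleys become invisible and the sum is [c ^ (n - 1)] times the Eulerian
    polynomial at [omega] ([valley_sum_eulerian]), which is in turn the numerator
    of the series of [k ^ n * omega ^ k] ([power_series_eulerian]). *)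

Set Implicit Arguments.
Unset Strict Implicit.
Unset Printing Implicit Defensive.

Import Order.TTheory GRing.Theory Num.Theory.
Import numFieldNormedType.Exports.
Local Open Scope classical_set_scope.
Local Open Scope ring_scope.

(** * Weights of descent words *)

Section ValleyWeight.
Variable K : comNzRingType.
Implicit Types (x a b : K) (d : bitseq).

(** Two valleys never share an adjacent pair, so a greedy parse from the left
    finds them all. *)
Fixpoint valley_weight x a b d : K :=
  match d with
  | [::] => 1
  | false :: r => a * valley_weight x a b r
  | true :: r =>
      match r with
      | false :: r' => x * valley_weight x a b r'
      | _ => b * valley_weight x a b r
      end
  end.

End ValleyWeight.

(** In a descent word ([true] for a descent), inserting a new minimum between two
    adjacent entries replaces their letter by a valley, and inserting it at the
    end appends a descent. *)
Fixpoint insert_inner (d : bitseq) : seq bitseq :=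
  if d is e :: r
  then (true :: false :: r) :: [seq e :: d' | d' <- insert_inner r]
  else [:: [:: true]].

Definition insert_min (d : bitseq) : seq bitseq := (false :: d) :: insert_inner d.

(** The descent words of all permutations of [n.+1] letters, with multiplicity;
    see [sum_descent_word]. *)
Fixpoint descent_words (n : nat) : seq bitseq :=
  if n is n'.+1 then flatten [seq insert_min d | d <- descent_words n']
  else [:: [::]].

Definition valley_sum (K : comNzRingType) (n : nat) (x a b : K) : K :=
  \sum_(d <- descent_words n) valley_weight x a b d.

(** Induction along the greedy parse of [valley_weight]. *)
Lemma bitseq2_ind (P : bitseq -> Prop) :
  P [::] -> (forall r, P r -> P (false :: r)) -> P [:: true] ->
  (forall r, P r -> P [:: true, false & r]) ->
  (forall r, P (true :: r) -> P [:: true, true & r]) ->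
  forall d, P d.
Proof.
move=> P0 PF PT PTF PTT d; have [k] := ubnP (size d).
elim: k d => // k IH [|[] [|[] r]] //= sz.
- by apply: PTT; apply: IH.
- by apply: PTF; apply: IH; apply: ltnW.
- by apply: PF; apply: IH.
- by apply: PF; apply: IH.
- by apply: PF; apply: IH.
Qed.

Lemma rmorph_valley_weight (K L : comNzRingType) (f : {rmorphism K -> L})
    (x a b : K) d :
  f (valley_weight x a b d) = valley_weight (f x) (f a) (f b) d.
Proof.
elim/bitseq2_ind: d => [|r IH||r IH|r IH]; rewrite ?rmorph1 //.
- by rewrite /= rmorphM IH.
- by rewrite /= rmorphM rmorph1.
- by rewrite /= rmorphM IH.
- by rewrite [LHS]rmorphM IH.
Qed.

(** * Invariance of the valley sum *)

Section Perturbation.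
Variable K : comNzRingType.

(** First-order perturbation: the coefficient of ['X] of a polynomial expression
    in perturbed arguments is its derivative, for the derivation that sends [y]
    to [y']. *)
Definition perturb (y y' : K) : {poly K} := y%:P + y' *: 'X.

Lemma coef0_perturb (y y' : K) : (perturb y y')`_0 = y.
Proof. by rewrite /perturb coefD coefC coefZ coefX /= mulr0 addr0. Qed.

Lemma coef1_perturb (y y' : K) : (perturb y y')`_1 = y'.
Proof. by rewrite /perturb coefD coefC coefZ coefX /= mulr1 add0r. Qed.

Lemma coef1M (f g : {poly K}) : (f * g)`_1 = f`_0 * g`_1 + f`_1 * g`_0.
Proof. by rewrite coefM !big_ord_recl big_ord0 /= addr0. Qed.

Variables x a b : K.
Let s := a + b.
Let xe := perturb x (s * x).
Let ae := perturb a x.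
Let be := perturb b x.

Lemma coef0_valley_weight d :
  (valley_weight xe ae be d)`_0 = valley_weight x a b d.
Proof.
have := rmorph_valley_weight (coefp 0) xe ae be d.
by rewrite /= !coef0_perturb.
Qed.

(** Inserting a minimum acts on weights as the derivation with [a' = b' = x] and
    [x' = (a + b) x]: a pair outside valleys is replaced by a valley, and
    inserting next to the bottom of a valley moves the valley and creates one
    extra ascent or descent.  The term in [b] is the insertion at the end. *)
Lemma valley_weight_insert_inner d :
  \sum_(d' <- insert_inner d) valley_weight x a b d' =
  b * valley_weight x a b d + (valley_weight xe ae be d)`_1.
Proof.
have w0 := coef0_valley_weight.
elim/bitseq2_ind: d => [|r IH||r IH|r IH].
- by rewrite big_seq1 /= coef1 addr0.
- rewrite /= big_cons big_map -big_distrr /= IH coef1M w0 /ae coef0_perturb.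
  rewrite coef1_perturb; ring.
- rewrite /= !big_cons big_nil /= coef1M /be coef0_perturb coef1_perturb.
  by rewrite coef1 coefC /=; ring.
- rewrite /= !big_cons !big_map -big_distrr /= IH coef1M w0 /xe coef0_perturb.
  rewrite coef1_perturb /s; ring.
- have -> : valley_weight xe ae be [:: true, true & r] =
            be * valley_weight xe ae be (true :: r) by [].
  (* Every insertion into a word starting with a descent starts with a descent,
     so prepending another descent multiplies all weights by [b]. *)
  have -> : \sum_(d' <- insert_inner [:: true, true & r]) valley_weight x a b d' =
    x * valley_weight x a b (true :: r) +
    b * \sum_(d' <- insert_inner (true :: r)) valley_weight x a b d'.
    by rewrite /= !big_cons !big_map mulrDr big_distrr.
  rewrite IH coef1M w0 /be coef0_perturb coef1_perturb.
  rewrite -[valley_weight _ _ _ [:: true, true & r]]/(b * valley_weight x a b (true :: r)).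
  ring.
Qed.

Lemma valley_weight_insert_min d :
  \sum_(d' <- insert_min d) valley_weight x a b d' =
  s * valley_weight x a b d + (valley_weight xe ae be d)`_1.
Proof. by rewrite big_cons valley_weight_insert_inner /s /=; ring. Qed.

Lemma valley_sumS n :
  valley_sum n.+1 x a b = s * valley_sum n x a b + (valley_sum n xe ae be)`_1.
Proof.
rewrite /valley_sum /= big_flatten big_map big_distrr coef_sum -big_split /=.
by apply: eq_bigr => d _; rewrite valley_weight_insert_min.
Qed.

End Perturbation.

(** The recursion of [valley_sumS] involves only [x] and [a + b]: the perturbed
    arguments again have sums that agree, so the induction closes provided that
    the ring is allowed to vary. *)
Lemma valley_sum_invariant n (K : comNzRingType) (x a b c e : K) :
  a + b = c + e -> valley_sum n x a b = valley_sum n x c e.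
Proof.
elim: n K x a b c e => [|n IH] K x a b c e eqs.
  by rewrite /valley_sum !big_seq1.
rewrite !valley_sumS eqs (IH _ _ _ _ _ _ eqs) (IH _ _ _ _ (perturb c x) (perturb e x)) //.
rewrite /perturb addrACA -polyCD eqs polyCD; ring.
Qed.

(** * Eulerian polynomials *)

Lemma size_insert_min d d' : d' \in insert_min d -> size d' = (size d).+1.
Proof.
rewrite inE => /orP[/eqP -> //|].
elim: d d' => [|e r IH] d' /=; first by rewrite inE => /eqP ->.
rewrite inE => /orP[/eqP -> //|/mapP[r' /IH sz ->]]; by rewrite /= sz.
Qed.

Lemma size_descent_words n d : d \in descent_words n -> size d = n.
Proof.
elim: n d => [|n IH] d /=; first by rewrite inE => /eqP ->.
by case/flatten_mapP => d' /IH <- /size_insert_min.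
Qed.

(** When a valley weighs as much as one ascent times one descent, the weight
    merely counts ascents and descents. *)
Lemma valley_weight_split (K : comNzRingType) (c w : K) d :
  valley_weight (c * (c * w)) c (c * w) d = c ^+ size d * w ^+ count id d.
Proof.
elim/bitseq2_ind: d => [|r IH||r IH|r IH].
- by rewrite /= !expr0 mulr1.
- by rewrite /= IH /= add0n exprS; ring.
- by rewrite /= !expr1; ring.
- by rewrite /= IH add0n add1n !exprS; ring.
- rewrite -[LHS]/(_ * valley_weight (c * (c * w)) c (c * w) (true :: r)) IH.
  by rewrite /= !add1n !exprS; ring.
Qed.

Lemma valley_weight_scale_desc (K : comNzRingType) (t x a b : K) d :
  valley_weight (t * x) a (t * b) d = t ^+ count id d * valley_weight x a b d.
Proof.
elim/bitseq2_ind: d => [|r IH||r IH|r IH].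
- by rewrite /= !expr0 mulr1.
- by rewrite /= IH /= add0n; ring.
- by rewrite /= !expr1; ring.
- by rewrite /= IH add0n add1n exprS; ring.
- rewrite -[LHS]/(_ * valley_weight (t * x) a (t * b) (true :: r)) IH.
  by rewrite /= !add1n !exprS; ring.
Qed.

Definition eulerian (R : comNzRingType) n : {poly R} :=
  \sum_(d <- descent_words n) 'X^(count id d).

(** Inserting a minimum into a descent keeps the number of descents; into an
    ascent, or at the end, it adds one.  The derivative counts the descents. *)
Lemma count_insert_inner (R : comNzRingType) d :
  \sum_(d' <- insert_inner d) ('X^(count id d') : {poly R}) =
  'X^((count id d).+1) * (1 + (size d)%:R) + 'X * (1 - 'X) * ('X^(count id d))^`().
Proof.
have derX k : 'X * ('X^k)^`() = 'X^k *+ k :> {poly R}.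
  by rewrite derivXn; case: k => [|k]; rewrite ?mulr0n ?mulr0 // mulrnAr -exprS.
have {}derX k : 'X * (1 - 'X) * ('X^k)^`() = (1 - 'X) * ('X^k * k%:R) :> {poly R}.
  by rewrite mulrAC derX mulrC mulr_natr.
elim: d => [|e r IH].
  by rewrite /= big_seq1 /= derivXn mulr0n !mulr0 !addr0 mulr1.
rewrite /= big_cons big_map /=.
under eq_bigr => d' _ do rewrite exprD.
rewrite -big_distrr /= IH !derX /= -!natr1 !add0n !add1n.
by case: e; rewrite /= ?add0n ?add1n -?natr1 ?expr0 ?expr1 !exprS; ring.
Qed.

Lemma eulerianS (R : comNzRingType) n :
  eulerian R n.+1 =
  (1 + (n.+1)%:R * 'X) * eulerian R n + 'X * (1 - 'X) * (eulerian R n)^`().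
Proof.
rewrite /eulerian /= big_flatten big_map big_distrr raddf_sum big_distrr -big_split /=.
apply: eq_big_seq => d /size_descent_words sz.
rewrite big_cons count_insert_inner /= add0n sz -natr1 exprS.
ring.
Qed.

Lemma valley_sum_eulerian (K : comNzRingType) n (c w : K) :
  valley_sum n (c * (c * w)) c (c * w) = c ^+ n * (eulerian K n).[w].
Proof.
rewrite /valley_sum /eulerian horner_sum big_distrr /=.
apply: eq_big_seq => d /size_descent_words sz.
by rewrite valley_weight_split sz hornerXn.
Qed.

(** * Permutations and their descent words *)

Definition descent_word (s : seq nat) : bitseq :=
  if s is y :: s' then pairmap (fun b c => (c < b)%N) y s' else [::].

Definition oneline n (pi : {perm 'I_n}) : seq nat := [seq val (pi i) | i <- enum 'I_n].

Lemma size_oneline n (pi : {perm 'I_n}) : size (oneline pi) = n.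
Proof. by rewrite size_map size_enum_ord. Qed.

Lemma size_descent_word s : size (descent_word s) = (size s).-1.
Proof. by case: s => //= y s; rewrite size_pairmap. Qed.

Lemma nth_oneline n (pi : {perm 'I_n}) (i : 'I_n) : nth 0%N (oneline pi) i = pi i.
Proof. by rewrite (nth_map i) ?size_enum_ord // nth_ord_enum. Qed.

Lemma nth_descent_word s i : (i.+1 < size s)%N ->
  nth false (descent_word s) i = (nth 0 s i.+1 < nth 0 s i)%N.
Proof.
case: s => //= y s; rewrite ltnS => lt_i.
by rewrite (nth_pairmap 0%N).
Qed.

Lemma des_descent_word n (pi : {perm 'I_n}) : des pi = count id (descent_word (oneline pi)).
Proof.
case: n pi => [|n] pi.
  rewrite /des eq_card0; last by case.
  by rewrite /oneline; case: (enum 'I_0) (size_enum_ord 0).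
rewrite -(mkseq_nth false (descent_word _)) size_descent_word size_oneline /=.
rewrite count_map /des -sum1_card -sum1_count big_mkcond /= big_ord_recr /=.
(* The last position has no successor, hence no descent. *)
rewrite ifN ?addn0; last first.
  by apply/existsPn => j; rewrite ltn_eqF ?ltn_ord.
have iotaE k : iota 0 k = index_iota 0 k by rewrite /index_iota subn0.
rewrite [RHS]big_mkcond iotaE big_mkord; apply: eq_bigr => i _.
have lt_i : (i.+1 < size (oneline pi))%N by rewrite size_oneline ltnS.
rewrite -[val _]/(nat_of_ord i) nth_descent_word //.
have := nth_oneline pi (lift ord0 i); rewrite lift0 => ->.
have := nth_oneline pi (widen_ord (leqnSn n) i) => /= ->.
congr (if _ then _ else _); apply/existsP/idP => [[j /andP[/eqP ej]]|lt_pi].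
  by have -> : lift ord0 i = j by apply: val_inj; exact: esym ej.
by exists (lift ord0 i); rewrite lift0 eqxx.
Qed.

Lemma descent_word_map_succ s : descent_word [seq k.+1 | k <- s] = descent_word s.
Proof. by case: s => //= y s; elim: s y => //= z s IH y; rewrite IH. Qed.

Definition insert_at (T : Type) (z : T) i (s : seq T) := take i s ++ z :: drop i s.

(** The least letter is preceded by a descent and followed by an ascent whatever
    its neighbours are; positivity makes [0] the least letter. *)
Lemma descent_words_insert0 s : all (leq 1) s -> (0 < size s)%N ->
  [seq descent_word (insert_at 0%N i s) | i <- iota 0 (size s).+1] =
  insert_min (descent_word s).
Proof.
case: s => // y s /andP[y0 s0] _.
rewrite -[iota 0 _]/(0%N :: iota (1 + 0) (size s).+1) map_cons; congr (_ :: _).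
rewrite iotaDl -map_comp; elim: s y y0 s0 => [|z s IH] y y0; first by rewrite /= y0.
case/andP=> z0 s0; rewrite -[size (z :: s)]/(size s).+1.
rewrite -[RHS]/((true :: false :: descent_word (z :: s)) ::
  [seq (z < y)%N :: d | d <- insert_inner (descent_word (z :: s))]) -(IH z) //.
rewrite -[iota 0 (_.+2)]/(0%N :: iota (1 + 0) (size s).+1) map_cons iotaDl -!map_comp.
by congr (_ :: _); rewrite /= y0.
Qed.

Lemma oneline_lift_perm n (i : 'I_n.+1) (pi : {perm 'I_n}) :
  oneline (lift_perm i ord0 pi) = insert_at 0%N i [seq k.+1 | k <- oneline pi].
Proof.
set s := [seq _ | _ <- _]; have sz : size s = n by rewrite size_map size_oneline.
have le_in : (i <= n)%N by rewrite -ltnS.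
apply: (@eq_from_nth _ 0%N).
  by rewrite size_cat /= size_take size_drop sz size_oneline; case: ltngtP le_in; lia.
move=> j; rewrite size_oneline => lt_j.
rewrite -[j]/(nat_of_ord (Ordinal lt_j)) nth_oneline nth_cat size_takel ?sz //.
case: (unliftP i (Ordinal lt_j)) => [k|] ->; last first.
  by rewrite lift_perm_id ltnn subnn.
rewrite lift_perm_lift lift0 /=.
have ns : nth 0%N s k = (pi k).+1.
  by rewrite (nth_map 0%N) ?size_oneline // nth_oneline.
rewrite /bump; case: (leqP i k) => [le_ik|lt_ki].
  rewrite add1n ltnNge ltnW ?ltnS //= subSn //= nth_drop subnKC // ns.
by rewrite add0n lt_ki nth_take // ns.
Qed.

(** [lift_perm i ord0] inserts the value [0] at position [i]; it is injective in
    [i] and [pi] together, and the cardinals agree. *)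
Lemma sum_lift_perm (R : nmodType) n (f : {perm 'I_n.+1} -> R) :
  \sum_pi f pi = \sum_(pi : {perm 'I_n}) \sum_(i < n.+1) f (lift_perm i ord0 pi).
Proof.
rewrite exchange_big pair_big /=.
rewrite (reindex (fun ip : 'I_n.+1 * {perm 'I_n} => lift_perm ip.1 ord0 ip.2)) //=.
apply/onW_bij/inj_card_bij => [[i pi] [j si] /= eq_ij|]; last first.
  by rewrite card_prod card_ord !card_Sn factS.
have {}eq_ij k : lift_perm i ord0 pi k = lift_perm j ord0 si k by rewrite eq_ij.
have eij : i = j.
  by apply: (@perm_inj _ (lift_perm j ord0 si)); rewrite -eq_ij !lift_perm_id.
rewrite -eij in eq_ij *; congr (_, _); apply/permP => k.
by apply: (@lift_inj _ ord0); rewrite -!(lift_perm_lift i) eq_ij.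
Qed.

(** Every permutation arises once by inserting the least value [0] into a smaller
    one, so the multiset of descent words obeys the recursion that defines
    [descent_words]. *)
Lemma sum_descent_word (R : nmodType) n (f : bitseq -> R) :
  \sum_(pi : {perm 'I_n.+1}) f (descent_word (oneline pi)) =
  \sum_(d <- descent_words n) f d.
Proof.
elim: n f => [|n IH] f.
  rewrite big_seq1 (bigD1 (1 : {perm 'I_1})%g) //= big1 ?addr0.
    by rewrite /oneline enum_ordSl enum_ord0.
  by move=> pi /eqP[]; apply/permP => i; rewrite !ord1.
rewrite sum_lift_perm /= big_flatten big_map -IH; apply: eq_bigr => pi _.
rewrite -descent_word_map_succ -descent_words_insert0; last 2 first.
- by rewrite all_map; apply/allP.
- by rewrite size_map size_oneline.
have iotaE k : iota 0 k = index_iota 0 k by rewrite /index_iota subn0.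
rewrite big_map size_map size_oneline iotaE big_mkord.
by apply: eq_bigr => i _; rewrite oneline_lift_perm.
Qed.

(** * Which choices produce a given deck *)

(** Can a card with choice [y] follow a card with choice [x] in the deck, where
    [e] tells whether the labels descend?  On one shelf the cards put on top come
    first and ascend; those put at the bottom descend. *)
Definition fits m (x : 'I_m * bool) (e : bool) (y : 'I_m * bool) : bool :=
  (x.1 < y.1)%N ||
  ((x.1 == y.1) && (if y.2 then x.2 && ~~ e else x.2 || e)).

Definition deck_le n m (w : choices n m) : rel 'I_n :=
  fun c c' => fits (w c) (c' < c)%N (w c').

Lemma pairwise_rev (T : Type) (r : rel T) (s : seq T) :
  pairwise r (rev s) = pairwise (fun x y => r y x) s.
Proof. by elim: s => //= x s IH; rewrite rev_cons pairwise_rcons all_rev IH. Qed.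

Section Deck.
Variables (n m : nat) (w : choices n m).

(** Cards are dealt by decreasing label, so those put on top end up ascending and
    those put at the bottom end up descending. *)
Lemma final_pilesE s :
  final_piles w s = [seq c <- enum 'I_n | w c == (s, true)] ++
                    rev [seq c <- enum 'I_n | w c == (s, false)].
Proof.
rewrite /final_piles foldl_rev; elim: (enum 'I_n) => //= c l IH.
rewrite /deal_card IH; case: (w c) => s' b /=; rewrite !xpair_eqE [s' == s]eq_sym.
case: (s == s') => //=; case: b => //=.
by rewrite rev_cons rcons_cat.
Qed.

Lemma deck_le_trans : transitive (deck_le w).
Proof.
move=> c2 c1 c3; rewrite /deck_le /fits.
case: (w c1) (w c2) (w c3) => [s1 b1] [s2 b2] [s3 b3] /=.
rewrite -!val_eqE /=; case: b1 b2 b3 => [] [] [] /=; lia.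
Qed.

Lemma deck_le_anti : antisymmetric (deck_le w).
Proof.
move=> c1 c2; rewrite /deck_le /fits => h; apply/val_inj; move: h.
case: (eqVneq c1 c2) => [->//|ne].
have : val c1 != val c2 by rewrite val_eqE.
case: (w c1) (w c2) => [s1 b1] [s2 b2] /=.
rewrite -!val_eqE /=; case: b1 b2 => [] [] /=; lia.
Qed.

Lemma pairwise_shuffled_deck :
  pairwise (fun c c' => (c != c') && deck_le w c c') (shuffled_deck w).
Proof.
have enum_lt k : pairwise (fun i j : 'I_k => (i < j)%N) (enum 'I_k).
  rewrite -[pairwise _ _]/(pairwise (relpre val ltn) _) -pairwise_map val_enum_ord.
  by rewrite -sorted_pairwise ?iota_ltn_sorted //; exact: ltn_trans.
have mem_pile s c : c \in final_piles w s -> (w c).1 = s.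
  by rewrite final_pilesE mem_cat mem_rev !mem_filter => /orP[] /andP[/eqP ->].
rewrite /shuffled_deck; elim: (enum 'I_m) (enum_lt m) => //= s l IH /andP[lt_s /IH {}IH].
rewrite pairwise_cat IH andbT; apply/andP; split.
  apply/allrelP => c c' /mem_pile ec /flatten_mapP[s' s'l /mem_pile ec'].
  have lt_ss' := allP lt_s _ s'l.
  rewrite /deck_le /fits ec ec' lt_ss' andbT; apply: contraTneq lt_ss' => ecc'.
  by rewrite -ec -ec' ecc' ltnn.
rewrite final_pilesE pairwise_cat pairwise_rev; apply/and3P; split.
- apply/allrelP => c c'; rewrite mem_rev !mem_filter => /andP[/eqP wc _] /andP[/eqP wc' _].
  rewrite /deck_le /fits wc wc' eqxx orbT andbT.
  by apply: contra_eq_neq wc => ->; rewrite wc'; apply/eqP; case.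
- apply: (sub_in_pairwise _ (filter_all _ _) (pairwise_filter _ (enum_lt n))).
  move=> c c' /eqP wc /eqP wc' lt_cc'; rewrite /deck_le /fits wc wc' eqxx /= -leqNgt.
  by rewrite (ltnW lt_cc') orbT andbT; apply: contraTneq lt_cc' => ->; rewrite ltnn.
- apply: (sub_in_pairwise _ (filter_all _ _) (pairwise_filter _ (enum_lt n))).
  move=> c c' /eqP wc /eqP wc' lt_cc'; rewrite /deck_le /fits wc wc' eqxx /= lt_cc'.
  by rewrite orbT andbT eq_sym; apply: contraTneq lt_cc' => ->; rewrite ltnn.
Qed.

Lemma mem_shuffled_deck (c : 'I_n) : c \in shuffled_deck w.
Proof.
have c_enum : c \in enum 'I_n by rewrite mem_enum.
apply/flatten_mapP; exists (w c).1; first by rewrite mem_enum.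
rewrite final_pilesE mem_cat mem_rev; apply/orP.
by case ew: (w c) => [s []]; [left|right]; rewrite mem_filter ew eqxx.
Qed.

(** Both lists enumerate all cards, and a list is determined by its content once
    it is sorted for a transitive and antisymmetric relation.  This turns a
    global condition on the deck into a condition on adjacent cards. *)
Lemma shuffled_deck_eq (pi : {perm 'I_n}) :
  (shuffled_deck w == [seq pi i | i <- enum 'I_n]) =
  sorted (deck_le w) [seq pi i | i <- enum 'I_n].
Proof.
have deck_sorted : sorted (deck_le w) (shuffled_deck w).
  rewrite sorted_pairwise; last exact: deck_le_trans.
  by apply: sub_pairwise pairwise_shuffled_deck => c c' /andP[].
have deck_uniq : uniq (shuffled_deck w).
  by apply: pairwise_uniq pairwise_shuffled_deck => c; rewrite eqxx.
apply/eqP/idP => [<- //|pi_sorted].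
apply: (sorted_eq deck_le_trans deck_le_anti) => //.
apply: uniq_perm; rewrite ?deck_uniq ?(map_inj_uniq (@perm_inj _ pi)) ?enum_uniq //.
move=> c; rewrite mem_shuffled_deck; apply/esym/mapP; exists (pi^-1 c)%g.
  by rewrite mem_enum.
by rewrite permKV.
Qed.

End Deck.

(** * Summing over the choices of the successive cards *)

Lemma big_tuple_cons (R : nmodType) (T : finType) k (F : seq T -> R) :
  \sum_(L : k.+1.-tuple T) F L = \sum_(x : T) \sum_(L : k.-tuple T) F (x :: L).
Proof.
rewrite pair_big /=.
rewrite (reindex (fun xL : T * k.-tuple T => [tuple of xL.1 :: xL.2])) //=.
exists (fun L : k.+1.-tuple T => (thead L, [tuple of behead L])) => [[x L]|L] _ /=.
  by rewrite theadE; congr (_, _); apply: val_inj.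
by rewrite [RHS]tuple_eta; apply: val_inj.
Qed.

Lemma sum_pair (R : nmodType) (S T : finType) (F : S * T -> R) :
  \sum_x F x = \sum_y \sum_z F (y, z).
Proof. by rewrite pair_bigA; apply: eq_bigr; case. Qed.

Section Letters.
Variables (R : comNzRingType) (m : nat) (p : R).
Local Notation letter := ('I_m * bool)%type.

Definition letter_weight (x : letter) : R := if x.2 then p else 1 - p.

(** Total weight of the choices for the cards that follow a card with choice [x],
    when the labels ascend and descend as prescribed by [d]. *)
Fixpoint letter_words_weight (x : letter) (d : bitseq) : R :=
  if d is e :: r then
    \sum_(y : letter | fits x e y) letter_weight y * letter_words_weight y r
  else 1.

Definition labelled_fits : rel (letter * nat) :=
  fun x y => fits x.1 (y.2 < x.2)%N y.1.

Lemma sum_path_letters (x : letter) v (s : seq nat) :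
  \sum_(L : (size s).-tuple letter | path labelled_fits (x, v) (zip L s))
     \prod_(l <- L) letter_weight l =
  letter_words_weight x (descent_word (v :: s)).
Proof.
elim: s x v => [|v' s IH] x v.
  rewrite (big_pred1 [tuple]) ?big_nil // => L.
  by rewrite tuple0 /= eqxx.
rewrite big_mkcond.
rewrite (big_tuple_cons _ (fun L : seq letter => if path labelled_fits (x, v) (zip L (v' :: s))
   then \prod_(l <- L) letter_weight l else 0)).
rewrite [RHS]/= [RHS]big_mkcond; apply: eq_bigr => y _.
rewrite -/(descent_word (v' :: s)) -IH /= /labelled_fits /=; case: ifP => _ /=; last first.
  by rewrite big1.
rewrite big_distrr [RHS]big_mkcond; apply: eq_bigr => L _.
by case: ifP; rewrite // big_cons.
Qed.

Lemma sum_sorted_letters k (s : seq nat) : size s = k.+1 ->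
  \sum_(L : k.+1.-tuple letter | sorted labelled_fits (zip L s))
     \prod_(l <- L) letter_weight l =
  \sum_(x : letter) letter_weight x * letter_words_weight x (descent_word s).
Proof.
case: s => // v s [<-]; rewrite big_mkcond.
rewrite (big_tuple_cons _ (fun L : seq letter => if sorted labelled_fits (zip L (v :: s))
   then \prod_(l <- L) letter_weight l else 0)).
apply: eq_bigr => x _; rewrite -sum_path_letters big_distrr [RHS]big_mkcond.
by apply: eq_bigr => L _; rewrite /=; case: ifP; rewrite // big_cons.
Qed.

Let a : {poly R} := 1 + p *: 'X.
Let b : {poly R} := 1 + (1 - p) *: 'X.

(** Generating polynomial of the ways to cut a deck with descent word [d] into
    nonempty piles, with ['X] marking the pairs left uncut.  A valley must be cut
    on at least one side; [1 + 'X] is the sum [1 + p 'X + (1 - p) 'X] of its three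
    cases. *)
Definition deck_poly (d : bitseq) : {poly R} := valley_weight (1 + 'X) a b d.

(** The refinement of [deck_poly] in which the choice of the first card is
    already made: after a card put at the bottom, an ascent must be cut. *)
Definition deck_poly_from (on_top : bool) (d : bitseq) : {poly R} :=
  if d is false :: r then (if on_top then 1 + 'X else 1) * deck_poly r else deck_poly d.

Lemma deck_poly_from_mix d :
  p *: deck_poly_from true d + (1 - p) *: deck_poly_from false d = deck_poly d.
Proof.
case: d => [|[] r] /=; rewrite -?scalerDl ?subrKC ?scale1r //.
rewrite -[RHS]/(a * deck_poly r) /a -!mul_polyC polyCB; ring.
Qed.

(** Either the first pair is cut, or the next card goes to the same shelf, on top
    or at the bottom. *)
Lemma deck_poly_from_cons top e r :
  deck_poly_from top (e :: r) = deck_poly r +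
    'X * ((if top && ~~ e then p *: deck_poly_from true r else 0) +
          (if top || e then (1 - p) *: deck_poly_from false r else 0)).
Proof.
have descE : deck_poly (true :: r) =
    deck_poly r + 'X * ((1 - p) *: deck_poly_from false r).
  case: r => [|[] r].
  - by rewrite -[LHS]/(b * 1) /deck_poly_from /deck_poly /= /b -!mul_polyC; ring.
  - rewrite -[LHS]/(b * deck_poly (true :: r)) /deck_poly_from /b -!mul_polyC; ring.
  - rewrite -[LHS]/((1 + 'X) * deck_poly r) -[deck_poly (false :: r)]/(a * deck_poly r).
    by rewrite /deck_poly_from /a -!mul_polyC polyCB; ring.
case: top e => [] [] /=; rewrite ?add0r ?descE //.
- by rewrite deck_poly_from_mix; ring.
- by rewrite mulr0 addr0 mul1r.
Qed.

Lemma size_deck_poly d : (size (deck_poly d) <= (size d).+1)%N.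
Proof.
have size_lin (c : R) : (size (1 + c *: 'X)%R <= 2)%N.
  rewrite (leq_trans (size_polyD _ _)) // size_poly1 geq_max /=.
  by rewrite (leq_trans (size_scale_leq _ _)) ?size_polyX.
have size_mul (c : R) (f : {poly R}) k : (size f <= k.+1)%N -> (size ((1 + c *: 'X) * f)%R <= k.+2)%N.
  move=> lt_f; rewrite (leq_trans (size_polyMleq _ _)) //.
  have := size_lin c; lia.
rewrite /deck_poly -['X]scale1r.
elim/bitseq2_ind: d => [|r IH||r IH|r IH]; rewrite ?size_poly1 //.
- exact: size_mul.
- by apply: size_mul; rewrite size_poly1.
- by apply: leq_trans (size_mul _ _ _ IH) _.
- exact: size_mul IH.
Qed.

(** Telescoping of [(1 + X) ^+ j.+1 - (1 + X) ^+ j = X (1 + X) ^+ j]; the size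
    bound kills the contribution of [j = 0]. *)
Lemma sum_coef_pow (f : {poly R}) i k : (size f <= i.+1)%N ->
  \sum_(j < k) ((1 + 'X) ^+ j * f)`_i = ((1 + 'X) ^+ k * f)`_i.+1.
Proof.
move=> sz_f; elim: k => [|k IH].
  by rewrite big_ord0 expr0 mul1r nth_default.
rewrite big_ord_recr /= IH exprS -mulrA mulrDl mul1r coefD; congr (_ + _).
by rewrite coefXM.
Qed.

(** With [m - x.1.+1] shelves left, the factor [(1 + 'X) ^+ (m - x.1.+1)] chooses
    the shelves that receive the remaining piles. *)
Lemma letter_words_weightE (x : letter) d :
  letter_words_weight x d =
  ((1 + 'X) ^+ (m - x.1.+1) * deck_poly_from x.2 d)`_(size d).
Proof.
elim: d x => [|e r IH] [s top].
  rewrite /deck_poly /= mulr1 -horner_coef0 !hornerE expr1n //.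
rewrite [LHS]/= deck_poly_from_cons mulrDr coefD [size _]/= -sum_coef_pow ?size_deck_poly //.
rewrite mulrCA coefXM [in RHS]/=.
pose w (s' : 'I_m) (c : bool) := letter_weight (s', c) * letter_words_weight (s', c) r.
have letter_wE s' c : w s' c =
    ((if c then p else 1 - p) *: ((1 + 'X) ^+ (m - s'.+1) * deck_poly_from c r))`_(size r).
  by rewrite /w IH coefZ.
rewrite big_mkcond sum_pair /=.
under eq_bigr => s' _ do rewrite big_bool /fits /= -!/(w s' _).
rewrite (bigID (fun s' : 'I_m => (s < s')%N)) /=; congr (_ + _).
  (* Shelves beyond [s]: the first pair is cut. *)
  rewrite (reindex_inj rev_ord_inj) (big_ord_widen m
    (fun j => ((1 + 'X) ^+ j * deck_poly r)`_(size r))) ?leq_subr //=.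
  apply: eq_big => [i|i -> /=]; first by have := ltn_ord i; have := ltn_ord s; lia.
  rewrite !letter_wE /=.
  have -> : (m - (m - i.+1).+1 = i)%N by have := ltn_ord i; lia.
  by rewrite -coefD !scalerAr -mulrDr deck_poly_from_mix.
(* Shelf [s] itself: the first pair is uncut. *)
rewrite (bigD1 s) ?ltnn //= big1 ?addr0; last first.
  by move=> s' /andP[/negPf -> /negPf ne]; rewrite eq_sym ne /= addr0.
rewrite eqxx /= !letter_wE /=.
rewrite mulrDr coefD; congr (_ + _).
  by case: ifP; rewrite ?mulr0 ?coef0 // -scalerAr.
by case: ifP; rewrite ?mulr0 ?coef0 // -scalerAr.
Qed.

Lemma sum_letter_words d :
  \sum_(x : letter) letter_weight x * letter_words_weight x d =
  ((1 + 'X) ^+ m * deck_poly d)`_(size d).+1.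
Proof.
rewrite -sum_coef_pow ?size_deck_poly // (reindex_inj rev_ord_inj) /=.
rewrite sum_pair; apply: eq_bigr => s _; rewrite big_bool !letter_words_weightE /letter_weight /=.
by rewrite -!coefZ -coefD !scalerAr -mulrDr deck_poly_from_mix.
Qed.

End Letters.

(** * The law of the shuffle *)

(** For a fixed deck [pi] the choices may be read along the positions of [pi]
    instead of the labels; the condition of [shuffled_deck_eq] then only sees the
    descent word. *)
Lemma shelf_law_coef (R : realType) n m (p : R) (pi : {perm 'I_n.+1}) :
  shelf_law m p pi =
  (m%:R ^+ n.+1)^-1 *
  ((1 + 'X) ^+ m * deck_poly p (descent_word (oneline pi)))`_n.+1.
Proof.
have sz : size (oneline pi) = n.+1 by exact: size_oneline.
have szd : size (descent_word (oneline pi)) = n by rewrite size_descent_word sz.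
have := sum_letter_words m p (descent_word (oneline pi)).
rewrite szd => <-; rewrite -(@sum_sorted_letters _ _ _ n) // big_distrr /=.
rewrite /shelf_law.
pose f (L : n.+1.-tuple ('I_m * bool)) : choices n.+1 m :=
  [ffun c => tnth L ((pi^-1)%g c)].
have f_pi L i : f L (pi i) = tnth L i by rewrite ffunE permK.
rewrite (reindex f) /=; last first.
  exists (fun w : choices n.+1 m => [tuple w (pi i) | i < n.+1]) => [L|w] _.
    by apply: eq_from_tnth => i; rewrite tnth_mktuple f_pi.
  by apply/ffunP => c; rewrite ffunE tnth_mktuple permKV.
apply: eq_big => [L|L _].
  rewrite shuffled_deck_eq.
  have -> : zip L (oneline pi) =
      [seq (f L c, val c) | c <- [seq pi i | i <- enum 'I_n.+1]].
    rewrite -map_comp -[val L]map_tnth_enum /oneline.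
    by elim: (enum _) => //= i l ->; rewrite f_pi.
  by rewrite sorted_map.
rewrite /choices_prob big_split /= prodr_const card_ord exprVn; congr (_ * _).
rewrite (reindex_inj (@perm_inj _ pi)) big_tuple.
by apply: eq_bigr => i _; rewrite f_pi.
Qed.

(** * The series of powers *)

Section PowerSeries.
Variable R : realType.

(** Writing [w = v ^+ 2] leaves one factor [v ^+ N] to absorb each power of [N],
    which reduces the claim to a linear polynomial. *)
Lemma cvg_poly_geometric (g : {poly R}) (w : R) : 0 < w < 1 ->
  (w ^+ N * g.[N%:R]) @[N --> \oo] --> (0 : R).
Proof.
have linear_case (v : R) : 0 < v < 1 -> (v ^+ N * N%:R) @[N --> \oo] --> (0 : R).
  move=> /andP[v0 v1].
  have u01 : 0 < Num.sqrt v < 1.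
    by rewrite sqrtr_gt0 v0 -[ltRHS]sqrtr1 ltr_sqrt.
  move: (Num.sqrt v) (sqr_sqrtr (ltW v0)) u01 => u <- /andP[u0 u1] {v v0 v1}.
  (* [N u^N] is bounded by the geometric sum [1 + u + ... + u^(N-1)]. *)
  have le_u N : (u ^+ 2) ^+ N * N%:R <= (1 - u)^-1 * u ^+ N.
    rewrite -exprM mulnC exprM expr2 -mulrA [leRHS]mulrC ler_pM2l ?exprn_gt0 //.
    rewrite -[leRHS]mul1r ler_pdivlMr ?subr_gt0 //.
    have -> : u ^+ N * N%:R * (1 - u) = (1 - u) * \sum_(k < N) u ^+ N.
      by rewrite sumr_const card_ord mulr_natr mulrC.
    apply: (@le_trans _ _ ((1 - u) * \sum_(k < N) u ^+ k)).
      rewrite ler_pM2l ?subr_gt0 // ler_sum // => k _.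
      exact: (ler_wiXn2l (ltW u0) (ltW u1) (ltnW (ltn_ord k))).
    by rewrite -opprB mulNr -subrX1 opprB lerBlDr lerDl exprn_ge0 // ltW.
  apply: (@squeeze_cvgr _ _ _ _ (cst 0) (fun N => (1 - u)^-1 * u ^+ N)).
  - by near=> N; rewrite le_u andbT mulr_ge0 // exprn_ge0 // exprn_ge0 // ltW.
  - exact: cvg_cst.
  - rewrite -(mulr0 (1 - u)^-1); apply: cvgMl_tmp; apply: cvg_expr.
    by rewrite gtr0_norm.
elim/poly_ind: g w => [|g c IH] w w01.
  by under eq_fun do rewrite horner0 mulr0; exact: cvg_cst.
have /andP[w0 w1] := w01.
have v01 : 0 < Num.sqrt w < 1.
  by rewrite sqrtr_gt0 w0 -[ltRHS]sqrtr1 ltr_sqrt.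
have wE N : w ^+ N * (g * 'X + c%:P).[N%:R] =
   (Num.sqrt w ^+ N * g.[N%:R]) * (Num.sqrt w ^+ N * N%:R) + c * w ^+ N.
  have -> : w ^+ N = Num.sqrt w ^+ N * Num.sqrt w ^+ N.
    by rewrite -exprMn -expr2 sqr_sqrtr // ltW.
  by rewrite hornerMXaddC; ring.
under eq_fun do rewrite wE.
have lim0 : 0 * 0 + c * 0 = 0 :> R by ring.
rewrite -lim0.
apply: cvgD; first by apply: cvgM; [exact: IH|exact: linear_case].
by apply: cvgMl_tmp; apply: cvg_expr; rewrite gtr0_norm.
Unshelve. all: by end_near.
Qed.

(** The partial sums are obtained from one another by the operator [f |-> 'X * f'],
    to which the recursion of the Eulerian polynomials corresponds; what matters
    about the remainder is that its dependence on [N] is ['X^N] times a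
    polynomial in [N], a form that this operator preserves. *)
Lemma partial_sum_remainder n : exists G : {poly {poly R}}, forall N,
  (1 - 'X) ^+ n.+2 * (\sum_(k < N) k%:R ^+ n.+1 * 'X^k) =
  'X * eulerian R n - 'X^N * G.[N%:R].
Proof.
elim: n => [|n [G GE]].
  exists ('X * (1 - 'X)%:P + ('X)%:P) => N.
  rewrite /eulerian big_seq1 /= expr0 mulr1 !hornerE.
  elim: N => [|N IH]; first by rewrite big_ord0 expr0; ring.
  rewrite big_ord_recr /= mulrDr IH expr1 -natr1 (exprS 'X N); ring.
exists (('X * (1 - 'X)%:P + (n.+2%:R * 'X)%:P) * G +
  ('X * (1 - 'X))%:P * \poly_(i < size G) (G`_i)^`()) => N.
have deriv_nat k l : (k%:R ^+ l : {poly R})^`() = 0.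
  by rewrite -natrX -polyC_natr derivC.
have derivG : (\poly_(i < size G) (G`_i)^`()).[N%:R] = (G.[N%:R])^`().
  rewrite horner_poly horner_coef raddf_sum; apply: eq_bigr => i _.
  by rewrite /= derivM deriv_nat mulr0 addr0.
have derivXN k : 'X * ('X^k)^`() = k%:R * 'X^k :> {poly R}.
  rewrite derivXn; case: k => [|k]; first by rewrite mulr0n mulr0 mul0r.
  by rewrite mulr_natl mulrnAr -exprS.
have sumS : \sum_(k < N) k%:R ^+ n.+2 * 'X^k =
    'X * (\sum_(k < N) k%:R ^+ n.+1 * 'X^k)^`() :> {poly R}.
  rewrite raddf_sum big_distrr; apply: eq_bigr => [[k _] _] /=.
  by rewrite derivM deriv_nat mul0r add0r mulrCA derivXN mulrA -exprSr.
(* Here [u] and [c] stand for [(1 - X) ^+ n.+1] and [n.+2], and a prime for the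
   derivative. *)
have step (X u T T' E E' H H' Y Y' c k : {poly R}) :
    (1 - X) * u * T = X * E - Y * H ->
    (1 - X) * u * T' - c * u * T = E + X * E' - (Y' * H + Y * H') ->
    X * Y' = k * Y ->
    (1 - X) * ((1 - X) * u) * (X * T') =
    X * ((1 + (c - 1) * X) * E + X * (1 - X) * E')
    - Y * ((k * (1 - X) + c * X) * H + X * (1 - X) * H').
  move=> eT eT' eY.
  transitivity (X * (1 - X) * ((1 - X) * u * T' - c * u * T) + c * X * ((1 - X) * u * T)).
    by ring.
  rewrite eT eT'.
  transitivity (X * ((1 + (c - 1) * X) * E + X * (1 - X) * E')
    - (Y * (c * X * H + X * (1 - X) * H') + (X * Y') * (1 - X) * H)); first by ring.
  by rewrite eY; ring.
have deriv_pow : ((1 - 'X) ^+ n.+2 : {poly R})^`() = - (n.+2%:R * (1 - 'X) ^+ n.+1).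
  by rewrite deriv_exp derivB derivX -polyC1 derivC sub0r mulN1r mulNrn mulr_natl.
have eT := GE N; have := congr1 (@deriv R) eT.
rewrite derivB (derivM (_ ^+ _)) (derivM 'X) (derivM 'X^N) deriv_pow derivX mul1r mulNr addrC => eT'.
rewrite exprS in eT eT'; have := step _ _ _ _ _ _ _ _ _ _ _ _ eT eT' (derivXN N).
rewrite eulerianS sumS (exprS _ n.+2) (exprS _ n.+1) => ->.
by rewrite !(hornerD, hornerM, hornerC, hornerX) derivG -[n.+2%:R]natr1; ring.
Qed.

Lemma power_series_eulerian n (w : R) : 0 < w < 1 ->
  limn (fun N => \sum_(1 <= k < N) k%:R ^+ n.+1 * w ^+ k) =
  w * (eulerian R n).[w] / (1 - w) ^+ n.+2.
Proof.
move=> w01; have /andP[w0 w1] := w01; have [G GE] := partial_sum_remainder n.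
have w1n : (1 - w) ^+ n.+2 != 0 by rewrite expf_neq0 // subr_eq0 gt_eqF.
apply: cvg_lim => //.
have sumE N : \sum_(1 <= k < N) k%:R ^+ n.+1 * w ^+ k =
    (w * (eulerian R n).[w] - w ^+ N * (map_poly (horner_eval w) G).[N%:R])
    / (1 - w) ^+ n.+2.
  apply: (canRL (mulfK w1n)).
  have -> : (map_poly (horner_eval w) G).[N%:R] = G.[N%:R].[w].
    by rewrite -(rmorph_nat (horner_eval w) N) horner_map.
  transitivity ((1 - w) ^+ n.+2 * \sum_(k < N) k%:R ^+ n.+1 * w ^+ k).
    rewrite mulrC; congr (_ * _); rewrite -(big_mkord xpredT (fun k => k%:R ^+ n.+1 * w ^+ k)).
    case: N => [|N]; first by rewrite !big_geq.
    by rewrite [RHS]big_ltn // expr0n mul0r add0r.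
  have := congr1 (horner_eval w) (GE N).
  rewrite /horner_eval !hornerE horner_sum => <-; congr (_ * _).
  by apply: eq_bigr => k _; rewrite -natrX -polyC_natr !hornerE natrX.
under eq_fun do rewrite sumE.
apply: cvgMr_tmp.
have lim0 : w * (eulerian R n).[w] - 0 = w * (eulerian R n).[w] by rewrite subr0.
rewrite -{2}lim0.
by apply: cvgB; [exact: cvg_cst|exact: cvg_poly_geometric].
Qed.

End PowerSeries.

(** * The generating function of descents *)

Section GeneratingFunction.
Variables (R : realType) (p t : R).

(** Each descent, whether inside a valley or not, carries a factor [t]; the
    leading [t] accounts for the exponent [des + 1]. *)
Definition gf_poly (m n : nat) : {poly R} :=
  t *: ((1 + 'X) ^+ m *
    valley_sum n (t%:P * (1 + 'X)) (1 + p *: 'X) (t%:P * (1 + (1 - p) *: 'X))).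

Lemma des_gf_coef m n :
  des_gf n.+1 m p t = (m%:R ^+ n.+1)^-1 * (gf_poly m n)`_n.+1.
Proof.
rewrite /des_gf /gf_poly coefZ /valley_sum big_distrr /= coef_sum.
rewrite -(sum_descent_word n (fun d => ((1 + 'X) ^+ m * valley_weight
  (t%:P * (1 + 'X)) (1 + p *: 'X) (t%:P * (1 + (1 - p) *: 'X)) d)`_n.+1)).
rewrite !big_distrr /=; apply: eq_bigr => pi _.
rewrite shelf_law_coef des_descent_word valley_weight_scale_desc -/(deck_poly p _).
rewrite (exprS t) -polyC_exp [(1 + 'X) ^+ m * (_ * _)]mulrCA coefCM; ring.
Qed.

Lemma horner_gf_poly m n (u : R) : (gf_poly m n).[u] =
  t * (1 + u) ^+ m * valley_sum n (t * (1 + u)) (1 + p * u) (t * (1 + (1 - p) * u)).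
Proof.
rewrite /gf_poly hornerZ hornerM horner_exp hornerD hornerX hornerC mulrA.
congr (_ * _); rewrite /valley_sum horner_sum; apply: eq_bigr => d _.
by rewrite -/(horner_eval u _) rmorph_valley_weight /= /horner_eval !hornerE.
Qed.

End GeneratingFunction.

Theorem theorem2p9 (R : realType) (m n : nat) (p : R)
    (hm : (1 <= m)%N) (hn : (1 <= n)%N) (hp : 0 < p < 1)
    (t : R) (ht : 0 < t) :
  exists P : {poly R},
    (forall u : R, 0 < u ->
       P.[u] =
       (1 + u) ^+ (m - 1)
       * (Afun p t u * ((1 - omega p t u) / (1 + omega p t u))) ^+ (n + 1)
       * limn (fun N => \sum_(1 <= k < N) k%:R ^+ n * omega p t u ^+ k)) /\
    des_gf n m p t = (m%:R ^+ n)^-1 * P`_n.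
Proof.
case: n hn => // n _; case: m hm => // m _.
exists (gf_poly p t m.+1 n); split; last exact: des_gf_coef.
move=> u u0; have [w01 wE] := omegaP hp ht u0.
move: (omega p t u) w01 wE => w /[dup] w01 /andP[w0 w1] wE.
rewrite power_series_eulerian // horner_gf_poly.
have w1_neq0 : 1 + w != 0 by rewrite gt_eqF // addr_gt0.
have wB_neq0 : 1 - w != 0 by rewrite subr_eq0 gt_eqF.
set A := Afun p t u in wE *.
have A_neq0 : A != 0.
  apply: contraTneq isT => A0; move/eqP: wE; rewrite A0 expr0n invr0 mulr0.
  by rewrite mulf_eq0 gt_eqF //= invr_eq0 expf_eq0 /= (negPf w1_neq0).
(* The equation of [omega] makes [c] and [c * w] the two numbers with sum [A]
   and product [t * (1 + u)]. *)
pose c := A / (1 + w).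
have cE : c * (c * w) = t * (1 + u).
  have -> : c * (c * w) = A ^+ 2 * (w / (1 + w) ^+ 2) by rewrite /c; field.
  by rewrite wE mulrC divfK // expf_neq0.
rewrite -(cE) (valley_sum_invariant _ _ (c := c) (e := c * w)); last first.
  by rewrite -[LHS]/(_ + _) /c /A /Afun; field.
rewrite valley_sum_eulerian.
have -> : A * ((1 - w) / (1 + w)) = c * (1 - w) by rewrite /c; field.
rewrite subn1 addn1 /= [(c * (1 - w)) ^+ _]exprMn.
transitivity ((1 + u) ^+ m * (c * (c * w)) * (c ^+ n * (eulerian R n).[w])).
  by rewrite cE exprS; ring.
rewrite !(exprS c); field.
by rewrite expf_neq0.
Qed.
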